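(* Let $n\ge1$, let $m\in\mathbb{R}$ and let $k,\ell$ be integers $\ge1$. For any polynomials $p\in\mathcal{P}_{2k}$, $q\in\mathcal{P}_{2\ell}$ on $\mathbb{R}^n$, the classes $S\big(\lambda_{g^{(p,q)}}^{m\left(\frac{k\ell}{k+\ell}\right)},g^{(p,q)}\big)$ all coincide and are equal to $\Sigma_{k,\ell}^m$.
   Context: $\Sigma_{k,\ell}^m$ is the set of all $a\in C^\infty(\mathbb{R}^n\times\mathbb{R}^n)$ such that for all multi-indices $\alpha,\beta$ there is $C_{\alpha\beta}>0$ with $|\partial_x^\beta\partial_\xi^\alpha a(x,\xi)|\le C_{\alpha\beta}(1+|x|^k+|\xi|^\ell)^{m-\frac{|\beta|}{k}-\frac{|\alpha|}{\ell}}$ for all $x,\xi\in\mathbb{R}^n$. For an integer $k\ge 1$, $\mathcal{P}_{2k}$ is the set of real-valued polynomials $p$ of order $2k$ on $\mathbb{R}^n$ with $\liminf_{|x|\to\infty} p(x)/|x|^{2k}>0$. Given $p\in\mathcal{P}_{2k}$, $q\in\mathcal{P}_{2\ell}$, fix constants $p_0,q_0>0$ such that $p(x)+p_0>0$ for all $x$ and $q(\xi)+q_0>0$ for all $\xi$. The metric $g=g^{(p,q)}$ on $\mathbb{R}^n\times\mathbb{R}^n$ is, at $X=(x,\xi)$, $$g_X=\frac{dx^2}{(p_0+q_0+p(x)+q(\xi))^{1/k}}+\frac{d\xi^2}{(p_0+q_0+p(x)+q(\xi))^{1/\ell}},$$ and its uncertainty parameter is $\lambda_g(x,\xi)=(p_0+q_0+p(x)+q(\xi))^{\frac{k+\ell}{2k\ell}}$.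 For a positive function $M$ on $\mathbb{R}^n\times\mathbb{R}^n$, $S(M,g)$ is the set of smooth functions $a$ on $\mathbb{R}^n\times\mathbb{R}^n$ such that for every integer $j\ge0$ there is $C_j>0$ with $|a^{(j)}(X;T_1,\dots,T_j)|\le C_jM(X)\prod_{i=1}^j g_X(T_i)^{1/2}$ for all $X,T_1,\dots,T_j\in\mathbb{R}^n\times\mathbb{R}^n$, where $a^{(j)}(X;T_1,\dots,T_j)$ is the $j$-th derivative of $a$ at $X$ in the directions $T_1,\dots,T_j$. *)

(* Defs.v *)
From HB Require Import structures.
From mathcomp Require Import all_boot all_order all_algebra.
From mathcomp Require Import all_classical all_reals all_analysis.
From mathcomp.real_closed Require Import complex.
(* The notations of mpoly clash with those of mathcomp-analysis. *)
From mathcomp.multinomials Require mpoly.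
Import -(notations) mpoly.

Set Implicit Arguments.
Unset Strict Implicit.
Unset Printing Implicit Defensive.

Import Order.TTheory GRing.Theory Num.Theory numFieldNormedType.Exports.

Local Open Scope classical_set_scope.
Local Open Scope ring_scope.

(* The complex numbers as a normed space over R (norm = modulus), so that
   functions of real variables with complex values have 'D_v derivatives. *)
Lemma Rcomplex_normrZ (R : realType) (t : R) (z : Rcomplex R) :
  `|t *: z| = `|t| * `|z|.
Proof.
case: z => a b; rewrite /Num.norm/= !exprMn -mulrDr.
by rewrite sqrtrM ?sqr_ge0// sqrtr_sqr.
Qed.

HB.instance Definition _ (R : realType) :=
  PseudoMetric.copy (Rcomplex R) (pseudoMetric_normed (Rcomplex R)).
HB.instance Definition _ (R : realType) := isPointed.Build (Rcomplex R) 0.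
HB.instance Definition _ (R : realType) :=
  NormedZmod_PseudoMetric_eq.Build R (Rcomplex R) erefl.
HB.instance Definition _ (R : realType) :=
  PseudoMetricNormedZmod_Lmodule_isNormedModule.Build R (Rcomplex R)
    (@Rcomplex_normrZ R).

(* iter_derive a [:: T_1; ...; T_j] X is a^(j)(X; T_1, ..., T_j). *)
Definition iter_derive (R : realType) (V W : normedModType R) (a : V -> W)
    (Ts : seq V) : V -> W :=
  foldr (fun T f => 'D_T f) a Ts.

Definition smooth (R : realType) (V W : normedModType R) (a : V -> W) : Prop :=
  forall (Ts : seq V) (X : V), differentiable (iter_derive a Ts) X.

(* Euclidean norm; the library norm on 'rV[R]_n is the max norm. *)
Definition eucl_norm (R : realType) (n : nat) (x : 'rV[R]_n) : R :=
  Num.sqrt (\sum_(i < n) x 0 i ^+ 2).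

Notation phase R n := ('rV[R]_n * 'rV[R]_n)%type.

Definition partial_x (R : realType) (n : nat) (beta : multinom n)
    (a : phase R n -> Rcomplex R) : phase R n -> Rcomplex R :=
  foldr (fun i f => iter (beta i) (fun h => 'D_(delta_mx 0 i, 0) h) f)
    a (enum 'I_n).

Definition partial_xi (R : realType) (n : nat) (alpha : multinom n)
    (a : phase R n -> Rcomplex R) : phase R n -> Rcomplex R :=
  foldr (fun i f => iter (alpha i) (fun h => 'D_(0, delta_mx 0 i) h) f)
    a (enum 'I_n).

Definition Sigma (R : realType) (n k l : nat) (m : R) :
    set (phase R n -> Rcomplex R) :=
  [set a | smooth a /\
    forall alpha beta : multinom n, exists C : R, 0 < C /\
      forall x xi : 'rV[R]_n,
        `|partial_x beta (partial_xi alpha a) (x, xi)| <=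
        C * (1 + eucl_norm x ^+ k + eucl_norm xi ^+ l) `^
              (m - (mdeg beta)%:R / k%:R - (mdeg alpha)%:R / l%:R)].

Definition peval (R : realType) (n : nat) (p : mpoly n R) (x : 'rV[R]_n) : R :=
  meval (fun i => x 0 i) p.

Definition eucl_infty (R : realType) (n : nat) : set_system 'rV[R]_n :=
  filter_from [set: R] (fun r => [set x | r < eucl_norm x]).

(* The class P_{2k}; msize is the total degree plus one. *)
Definition poly_class (R : realType) (n k : nat) : set (mpoly n R) :=
  [set p | mmeasure mdeg p = (2 * k).+1 /\
    (0 < limf_einf (fun x : 'rV[R]_n =>
           (peval p x / eucl_norm x ^+ (2 * k))%:E) (@eucl_infty R n))%E].

Definition hamiltonian (R : realType) (n : nat) (p q : mpoly n R) (p0 q0 : R)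
    (X : phase R n) : R :=
  p0 + q0 + peval p X.1 + peval q X.2.

(* g_X(T), as a quadratic form in T. *)
Definition metric (R : realType) (n k l : nat) (p q : mpoly n R) (p0 q0 : R)
    (X T : phase R n) : R :=
  eucl_norm T.1 ^+ 2 / hamiltonian p q p0 q0 X `^ k%:R^-1 +
  eucl_norm T.2 ^+ 2 / hamiltonian p q p0 q0 X `^ l%:R^-1.

Definition uncertainty (R : realType) (n k l : nat) (p q : mpoly n R)
    (p0 q0 : R) (X : phase R n) : R :=
  hamiltonian p q p0 q0 X `^ ((k + l)%:R / (2 * k * l)%:R).

(* The symbol class S(M, g). *)
Definition symbols (R : realType) (n : nat) (M : phase R n -> R)
    (g : phase R n -> phase R n -> R) : set (phase R n -> Rcomplex R) :=
  [set a | smooth a /\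
    forall j : nat, exists C : R, 0 < C /\
      forall (X : phase R n) (T : j.-tuple (phase R n)),
        `|iter_derive a T X| <=
        C * M X * \prod_(i < j) Num.sqrt (g X (tnth T i))].

(* Main.v *)
Require Import Defs.
From mathcomp Require Import all_boot all_order all_algebra.
From mathcomp Require Import all_classical all_reals all_analysis.
From mathcomp Require Import ring lra.
From mathcomp.real_closed Require Import complex.
From mathcomp.multinomials Require mpoly.
Import -(notations) mpoly.
Import Order.TTheory GRing.Theory Num.Theory numFieldNormedType.Exports.
Local Open Scope classical_set_scope.
Local Open Scope ring_scope.

Set Implicit Arguments.
Unset Strict Implicit.
Unset Printing Implicit Defensive.

(** Write [H] for the Hamiltonian [p0 + q0 + p(x) + q(xi)] and [w] for the
    weight [1 + |x|^k + |xi|^l].  The theorem rests on two independent facts.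

    The first is that [H] and [w^2] are comparable ([hamiltonian_weight]).  The
    upper bound holds because [p] and [q] have degrees [2k] and [2l].  For the
    lower bound, the liminf hypothesis makes [p] dominate [c |x|^(2k)] outside a
    ball, and on the ball the continuous positive function [p + p0] is bounded
    below by compactness ([peval_lower]).  Hence every real power of [H],
    whatever its sign, is comparable to the corresponding power of [w^2]
    ([powR_comparison]).  As [lambda_g^(m k l / (k + l)) = H^(m/2)]
    ([uncertainty_powR]) and as the [g]-lengths of the coordinate vectors in [x]
    and [xi] are [H^(-1/2k)] and [H^(-1/2l)] ([sqrt_metric_axis]), the bounds
    defining [Sigma] are, up to constants, those defining [S(H^(m/2), g)]
    restricted to coordinate directions.

    The second is that coordinate directions suffice.  Higher derivatives are
    symmetric by the Schwarz theorem, proved here from second differences and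
    the mean value theorem ([derive_comm_real]), and transported to complex
    values through the real and imaginary parts.  Hence the derivative along an
    arbitrary list of coordinate vectors is one of the mixed partial derivatives
    of the definition of [Sigma] ([Sigma_axes]).  A derivative along arbitrary
    directions is expanded one direction at a time on the coordinate basis; the
    coordinates of a vector are controlled by its [g]-length
    ([ler_coord_metric]), with a loss that compensates exactly the gain due to
    the additional coordinate derivative ([multilinear_bound]). *)

(** * Symmetry of iterated derivatives *)

Lemma ler_dist_half (R : realFieldType) (x y z e : R) :
  `|x - z| < e / 2 -> `|y - z| < e / 2 -> `|x - y| <= e.
Proof.
move=> xz yz; rewrite [leRHS]splitr (le_trans (ler_distD z _ _))//.
by rewrite lerD// ltW// distrC.
Qed.

Lemma is_derive_line (R : realType) (V W : normedModType R) (f : V -> W)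
    (Y u : V) (s : R) :
  derivable f (s *: u + Y) u ->
  is_derive s 1 (fun t => f (t *: u + Y)) ('D_u f (s *: u + Y)).
Proof.
move=> fu.
have E : (fun h : R => h^-1 *: (((fun t => f (t *: u + Y)) \o shift s) (h *: 1) -
    f (s *: u + Y))) =
  (fun h : R => h^-1 *: ((f \o shift (s *: u + Y)) (h *: u) - f (s *: u + Y))).
  apply/funext => h /=; congr (_ *: (f _ - _)).
  by rewrite [h *: 1]mulr1 scalerDl addrA.
apply: DeriveDef; first by rewrite /derivable E; exact: fu.
by rewrite /derive E.
Qed.

Lemma continuous_line (R : realType) (V W : normedModType R) (f : V -> W)
    (Y u : V) :
  (forall X, differentiable f X) -> continuous (fun t : R => f (t *: u + Y)).
Proof.
move=> df s; apply/differentiable_continuous/derivable1_diffP.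
by have [] := is_derive_line (@diff_derivable _ _ _ f _ u (df (s *: u + Y))).
Qed.

(** Two applications of the mean value theorem, first along [u] to the increment
    in the direction [v], then along [v]. The left-hand side is symmetric in
    [u] and [v], which is what makes the mixed derivatives agree. *)
Lemma second_difference (R : realType) (V : normedModType R) (f : V -> R)
    (u v X : V) (h : R) :
  (forall Y, differentiable f Y) -> (forall Y, differentiable ('D_u f) Y) ->
  0 < h ->
  exists s t : R, [/\ 0 < s < h, 0 < t < h &
    f (h *: u + (h *: v + X)) - f (h *: u + X) - (f (h *: v + X) - f X) =
    'D_v ('D_u f) (t *: v + (s *: u + X)) * h * h].
Proof.
move=> df dDf h0.
pose phi (s : R) := f (s *: u + (h *: v + X)) - f (s *: u + X).
have dphi (s : R) : is_derive s 1 phi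
    ('D_u f (s *: u + (h *: v + X)) - 'D_u f (s *: u + X)).
  by apply: is_deriveB; apply: is_derive_line; exact: diff_derivable.
have [s] := @MVT R phi _ 0 h h0 (fun s _ => dphi s)
  (continuous_subspaceT (fun s => cvgB (@continuous_line _ _ _ f (h *: v + X) u df s)
                                       (@continuous_line _ _ _ f X u df s))).
rewrite in_itv/= => sh phiE.
have [t] := @MVT R (fun t => 'D_u f (t *: v + (s *: u + X))) _ 0 h h0
  (fun t _ => is_derive_line (@diff_derivable _ _ _ _ _ v (dDf (t *: v + (s *: u + X)))))
  (continuous_subspaceT (@continuous_line _ _ _ _ _ _ dDf)).
rewrite in_itv/= => th psiE.
exists s, t; split=> //.
move: phiE psiE; rewrite /phi !scale0r !add0r subr0 => -> <-.
by rewrite [s *: u + (_ + _)]addrCA.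
Qed.

(** Schwarz: for every [h > 0], one mixed derivative at some point and the other
    at some other point, both at distance less than [h (|u| + |v|)] from [X],
    equal the same second difference divided by [h^2]; continuity at [X]
    concludes. *)
Lemma derive_comm_real (R : realType) (V : normedModType R) (f : V -> R)
    (u v X : V) :
  (forall Y, differentiable f Y) ->
  (forall Y, differentiable ('D_u f) Y) ->
  (forall Y, differentiable ('D_v f) Y) ->
  {for X, continuous ('D_v ('D_u f))} -> {for X, continuous ('D_u ('D_v f))} ->
  'D_v ('D_u f) X = 'D_u ('D_v f) X.
Proof.
move=> df du dv cvu cuv.
apply/eqP; rewrite -subr_eq0 -normr_le0; apply/ler_addgt0Pl => e e0.
rewrite addr0.
have e2 : 0 < e / 2 by rewrite divr_gt0.
have nA : nbhs X [set Y | `|'D_v ('D_u f) X - 'D_v ('D_u f) Y| < e / 2].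
  by move/cvgrPdist_lt: cvu => /(_ _ e2).
have nB : nbhs X [set Y | `|'D_u ('D_v f) X - 'D_u ('D_v f) Y| < e / 2].
  by move/cvgrPdist_lt: cuv => /(_ _ e2).
have [r r0 Br] := (nbhs_ballP _ _).1 (filterI nA nB).
(* The denominator makes [h (|u| + |v|) < r], even when [u = v = 0]. *)
pose h := r / (1 + `|u| + `|v|).
have d0 : 0 < 1 + `|u| + `|v| by rewrite -addrA ltr_pwDl// addr_ge0.
have h0 : 0 < h by rewrite divr_gt0.
have inB (s t : R) (a b : V) : 0 < s < h -> 0 < t < h ->
    `|a| + `|b| = `|u| + `|v| -> ball X r (t *: b + (s *: a + X)).
  move=> /andP[s0 sh] /andP[t0 th] ab.
  rewrite -ball_normE /ball_/= addrA opprD addrCA subrr addr0 normrN.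
  rewrite (le_lt_trans (ler_normD _ _))// !normrZ !gtr0_norm//.
  rewrite (@le_lt_trans _ _ (h * (`|u| + `|v|)))//.
    by rewrite -ab mulrDr addrC lerD// ler_wpM2r// ltW.
  by rewrite /h mulrAC ltr_pdivrMr// ltr_pM2l// -addrA ltrDr.
have [s [t [sh th E1]]] := second_difference v X df du h0.
have [s' [t' [sh' th' E2]]] := second_difference u X df dv h0.
have E : 'D_v ('D_u f) (t *: v + (s *: u + X)) =
         'D_u ('D_v f) (t' *: u + (s' *: v + X)).
  have hn0 : h != 0 by rewrite gt_eqF.
  have EE : f (h *: u + (h *: v + X)) - f (h *: u + X) - (f (h *: v + X) - f X) =
      f (h *: v + (h *: u + X)) - f (h *: v + X) - (f (h *: u + X) - f X).
    rewrite [h *: v + (h *: u + X)]addrCA !opprB !addrA.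
    by rewrite [LHS]addrAC [RHS]addrAC; congr (_ + _); exact: addrAC.
  by move: EE; rewrite E1 E2 => /(mulIf hn0)/(mulIf hn0).
have [A1 _] := Br _ (inB s t u v sh th erefl).
have [_] := Br _ (inB s' t' v u sh' th' (addrC _ _)).
rewrite /= -E => B1.
exact: ler_dist_half A1 B1.
Qed.

Lemma derive_linear_comp (R : realType) (V W Z : normedModType R)
    (L : {linear W -> Z}) (f : V -> W) (u X : V) :
  continuous L -> differentiable f X ->
  'D_u (L \o f) X = L ('D_u f X).
Proof.
move=> cL df; have dL := linear_differentiable (f X) cL.
rewrite !deriveE//; last exact: differentiable_comp.
by rewrite diff_comp// diff_lin.
Qed.

Lemma iter_derive_linear_comp (R : realType) (V W Z : normedModType R)
    (L : {linear W -> Z}) (f : V -> W) (us : seq V) :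
  continuous L -> smooth f -> iter_derive (L \o f) us = L \o iter_derive f us.
Proof.
move=> cL sf; elim: us => //= u us IH; apply/funext => X.
by rewrite IH derive_linear_comp.
Qed.

Lemma smooth_linear_comp (R : realType) (V W Z : normedModType R)
    (L : {linear W -> Z}) (f : V -> W) :
  continuous L -> smooth f -> smooth (L \o f).
Proof.
move=> cL sf us X; rewrite iter_derive_linear_comp//.
by apply: differentiable_comp => //; exact: linear_differentiable.
Qed.

Lemma smooth_iter_derive (R : realType) (V W : normedModType R)
    (f : V -> W) (us : seq V) : smooth f -> smooth (iter_derive f us).
Proof.
by move=> sf vs X; rewrite /iter_derive -foldr_cat; exact: sf.
Qed.

Lemma smooth_derive_comm_real (R : realType) (V : normedModType R) (f : V -> R)
    (u v : V) : smooth f -> 'D_v ('D_u f) = 'D_u ('D_v f).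
Proof.
move=> sf; apply/funext => X; apply: derive_comm_real.
- exact: (sf [::]).
- exact: (sf [:: u]).
- exact: (sf [:: v]).
- exact: differentiable_continuous (sf [:: v; u] X).
- exact: differentiable_continuous (sf [:: u; v] X).
Qed.

Lemma continuous_Re (R : realType) : continuous (@complex.Re R : Rcomplex R -> R).
Proof.
apply/linear_bounded_continuous; apply/bounded_funP => r; exists r => z.
apply: le_trans; case: z => a b; rewrite {2}/Num.norm/= -sqrtr_sqr.
by rewrite ler_wsqrtr// lerDl sqr_ge0.
Qed.

Lemma continuous_Im (R : realType) : continuous (@complex.Im R : Rcomplex R -> R).
Proof.
apply/linear_bounded_continuous; apply/bounded_funP => r; exists r => z.
apply: le_trans; case: z => a b; rewrite {2}/Num.norm/= -sqrtr_sqr.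
by rewrite ler_wsqrtr// lerDr sqr_ge0.
Qed.

(** The mean value theorem needs real values, so the real and imaginary parts are
    treated separately; both commute with derivatives, being continuous linear
    forms. *)
Lemma smooth_derive_comm (R : realType) (V : normedModType R)
    (f : V -> Rcomplex R) (u v : V) :
  smooth f -> 'D_v ('D_u f) = 'D_u ('D_v f).
Proof.
move=> sf; apply/funext => X; apply/eqP; rewrite eq_complex.
have cRe := @continuous_Re R; have cIm := @continuous_Im R.
have part (L : {linear Rcomplex R -> R}) : continuous L ->
    L ('D_v ('D_u f) X) = L ('D_u ('D_v f) X).
  move=> cL.
  have D (a b : V) : 'D_a ('D_b (L \o f)) = L \o 'D_a ('D_b f).
    exact: (iter_derive_linear_comp [:: a; b] cL sf).
  have E : L \o 'D_v ('D_u f) = L \o 'D_u ('D_v f).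
    exact: etrans (esym (D v u)) (etrans
      (smooth_derive_comm_real u v (smooth_linear_comp cL sf)) (D u v)).
  exact: (congr1 (@^~ X) E).
by apply/andP; split; apply/eqP; [exact: part _ cRe|exact: part _ cIm].
Qed.

Lemma perm_iter_derive (R : realType) (V : normedModType R)
    (f : V -> Rcomplex R) (us vs : seq V) :
  smooth f -> perm_eq us vs -> iter_derive f us = iter_derive f vs.
Proof.
move=> sf.
have catcons (u : V) (s t : seq V) :
    iter_derive f (s ++ u :: t) = iter_derive f (u :: s ++ t).
  elim: s => [//|w s E]; rewrite /= E /=.
  exact: smooth_derive_comm (smooth_iter_derive _ sf).
elim: us vs => [|u us IH] vs; first by move/perm_size; case: vs.
move=> uv; have uvs : u \in vs by rewrite -(perm_mem uv) mem_head.
case/splitPr: uvs uv => s t; rewrite catcons => uv /=.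
rewrite (IH (s ++ t))//.
by rewrite -(perm_cons u) (permPl uv) perm_catC/= perm_cons perm_catC.
Qed.

(** * Comparison of the Hamiltonian with the weight *)

Lemma eucl_norm_ge0 (R : realType) (n : nat) (x : 'rV[R]_n) : 0 <= eucl_norm x.
Proof. exact: sqrtr_ge0. Qed.

Lemma ler_coord_eucl_norm (R : realType) (n : nat) (x : 'rV[R]_n) (i : 'I_n) :
  `|x 0 i| <= eucl_norm x.
Proof.
rewrite /eucl_norm -sqrtr_sqr ler_wsqrtr// (bigD1 i)//= lerDl.
by apply: sumr_ge0 => j _; exact: sqr_ge0.
Qed.

Lemma eucl_norm_delta (R : realType) (n : nat) (i : 'I_n) :
  eucl_norm (delta_mx 0 i : 'rV[R]_n) = 1.
Proof.
rewrite /eucl_norm (bigD1 i)//= big1 => [|j ji]; last first.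
  by rewrite mxE eqxx (negPf ji) expr0n.
by rewrite mxE !eqxx expr1n addr0 sqrtr1.
Qed.

Lemma eucl_norm0 (R : realType) (n : nat) : eucl_norm (0 : 'rV[R]_n) = 0.
Proof.
by rewrite /eucl_norm big1 ?sqrtr0// => i _; rewrite mxE expr0n.
Qed.

Lemma ler_exprn_1D (R : realFieldType) (t : R) (d N : nat) :
  0 <= t -> (d <= N)%N -> t ^+ d <= 1 + t ^+ N.
Proof.
move=> t0 dN; have [t1|/ltW t1] := leP t 1.
  by rewrite (@le_trans _ _ 1)// ?exprn_ile1// lerDl exprn_ge0.
by rewrite (le_trans (ler_weXn2l _ dN))// lerDr.
Qed.

(** Each monomial of degree [d <= N] is at most [|x|^d], hence at most
    [1 + |x|^N]; summing the absolute values of the coefficients gives [C]. *)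
Lemma peval_upper (R : realType) (n N : nat) (p : mpoly n R) :
  (mmeasure mdeg p <= N.+1)%N ->
  exists2 C : R, 0 < C & forall x : 'rV[R]_n,
    peval p x <= C * (1 + eucl_norm x ^+ N).
Proof.
move=> degp; exists (1 + \sum_(mu <- msupp p) `|mcoeff mu p|).
  by rewrite ltr_pwDl// sumr_ge0.
move=> x; have e0 := eucl_norm_ge0 x.
rewrite mulrDl mul1r ler_wpDl//; first by rewrite addr_ge0// exprn_ge0.
rewrite /peval mevalE mulr_suml big_seq [leRHS]big_seq ler_sum// => mu mup.
rewrite (le_trans (ler_norm _))// normrM ler_wpM2l//.
have dmu : (mdeg mu <= N)%N by rewrite -ltnS (leq_trans (mmeasure_mnm_lt mdeg mup)).
rewrite (le_trans _ (ler_exprn_1D e0 dmu))// normr_prod mdegE expr_sum.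
apply: ler_prod => i _; rewrite normr_ge0 normrX lerXn2r ?nnegrE//.
exact: ler_coord_eucl_norm.
Qed.

Lemma continuous_peval (R : realType) (n : nat) (p : mpoly n R) :
  continuous (peval p).
Proof.
have -> : peval p = fun x => \sum_(mu <- msupp p)
    mcoeff mu p * \prod_(i < n) x 0 i ^+ mu i.
  by apply/funext => x; rewrite /peval mevalE.
apply: continuous_big => [|mu _]; first exact: add_continuous.
have cprod : continuous (fun x : 'rV[R]_n => \prod_(i < n) x 0 i ^+ mu i).
  apply: continuous_big => [|i _]; first exact: mul_continuous.
  move=> x.
  apply: (@continuous_comp _ _ _ (fun y : 'rV[R]_n => y 0 i) (fun t => t ^+ mu i)).
    exact: coord_continuous.
  exact: exprn_continuous.
move=> x; apply: (@continuous_comp _ _ _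
  (fun x : 'rV[R]_n => \prod_(i < n) x 0 i ^+ mu i) ( *%R (mcoeff mu p))).
  exact: cprod.
exact: mulrl_continuous.
Qed.

Lemma poly_class_growth (R : realType) (n k : nat) (p : mpoly n R) :
  poly_class k p ->
  exists c r : R, [/\ 0 < c, 0 < r & forall x : 'rV[R]_n,
    r < eucl_norm x -> c * eucl_norm x ^+ (2 * k) <= peval p x].
Proof.
move=> [_]; rewrite limf_einfE => /ereal_sup_gt[_ [V [r _ rV] <-]] infV.
have [c c0 cV] : exists2 c : R, 0 < c & forall x : 'rV[R]_n, V x ->
    c <= peval p x / eucl_norm x ^+ (2 * k).
  have lb (x : 'rV[R]_n) : V x -> (ereal_inf [set
      (peval p x / eucl_norm x ^+ (2 * k))%:E | x in V] <=
      (peval p x / eucl_norm x ^+ (2 * k))%:E)%E.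
    by move=> Vx; apply: ereal_inf_lbound; exists x.
  move: infV lb; case: ereal_inf => [c| |]//.
    by rewrite lte_fin => c0 lb; exists c => // x /lb; rewrite lee_fin.
  (* An infinite infimum of finite values forces [V] to be empty. *)
  by move=> _ lb; exists 1 => // x /lb; rewrite leye_eq.
(* A radius at least 1 keeps [x] away from 0, where the quotient degenerates. *)
exists c, (Num.max 1 r); split=> //; first by rewrite lt_max ltr01.
move=> x; rewrite gt_max => /andP[x1 xr].
have := cV _ (rV _ xr); rewrite ler_pdivlMr//.
by rewrite exprn_gt0// (lt_trans ltr01).
Qed.

(** The positivity of [p + p0] alone gives no uniform lower bound. Outside a ball
    the growth of [p] gives one; the ball is contained in a cube, which is
    compact, and there [p + p0] reaches a positive minimum. *)
Lemma peval_lower (R : realType) (n k : nat) (p : mpoly n R) (p0 : R) :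
  poly_class k p -> 0 < p0 -> (forall x : 'rV[R]_n, 0 < peval p x + p0) ->
  exists2 c : R, 0 < c & forall x : 'rV[R]_n,
    c * (1 + eucl_norm x ^+ (2 * k)) <= peval p x + p0.
Proof.
move=> /poly_class_growth[c [r [c0 r0 growth]]] p00 pos.
pose A : set 'rV[R]_n := [set x | forall i, x 0 i \in `[- r, r]].
have cA : compact A.
  apply: (@rV_compact _ _ (fun=> `[- r, r]%classic)) => _.
  exact: segment_compact.
have A0 : A 0 by move=> i; rewrite mxE in_itv/= oppr_le0 ltW.
have [z _ zmin] := compact_EVT_min (ex_intro _ _ A0) cA
  (continuous_subspaceT (@continuous_peval R n p)).
pose d := peval p z + p0.
have d0 : 0 < d by exact: pos.
have D0 : 0 < 1 + r ^+ (2 * k) by rewrite ltr_pwDl// exprn_ge0// ltW.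
exists (Num.min (d / (1 + r ^+ (2 * k))) (Num.min c p0)).
  by rewrite !lt_min c0 p00 divr_gt0.
move=> x; have e0 := eucl_norm_ge0 x.
have ge1 : 0 <= 1 + eucl_norm x ^+ (2 * k) by rewrite addr_ge0// exprn_ge0.
have [xr|xr] := leP (eucl_norm x) r.
  have Ax : x \in A.
    rewrite inE => i; rewrite in_itv/= -ler_norml.
    exact: le_trans (ler_coord_eucl_norm x i) xr.
  apply: (@le_trans _ _ d); last by rewrite lerD2r zmin.
  apply: (@le_trans _ _ (d / (1 + r ^+ (2 * k)) * (1 + eucl_norm x ^+ (2 * k)))).
    by rewrite ler_wpM2r// ge_min lexx.
  rewrite mulrAC ler_pdivrMr// ler_wpM2l ?(ltW d0)// lerD2l.
  by rewrite lerXn2r ?nnegrE// ltW.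
rewrite mulrDr mulr1 addrC lerD//.
  rewrite (le_trans _ (growth _ xr))// ler_wpM2r ?exprn_ge0//.
  by rewrite !ge_min lexx !orbT.
by rewrite !ge_min lexx !orbT.
Qed.

Definition symbol_weight (R : realType) (n k l : nat) (X : phase R n) : R :=
  1 + eucl_norm X.1 ^+ k + eucl_norm X.2 ^+ l.

Lemma symbol_weight_ge1 (R : realType) (n k l : nat) (X : phase R n) :
  1 <= symbol_weight k l X.
Proof. by rewrite /symbol_weight -addrA lerDl addr_ge0// exprn_ge0// eucl_norm_ge0. Qed.

Lemma symbol_weight_sqr (R : realType) (n k l : nat) (X : phase R n) :
  1 + eucl_norm X.1 ^+ (2 * k) + eucl_norm X.2 ^+ (2 * l) <= symbol_weight k l X ^+ 2
  <= 3 * (1 + eucl_norm X.1 ^+ (2 * k) + eucl_norm X.2 ^+ (2 * l)).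
Proof.
rewrite /symbol_weight ![(2 * _)%N]mulnC !exprM.
have := exprn_ge0 k (eucl_norm_ge0 X.1).
have := exprn_ge0 l (eucl_norm_ge0 X.2).
set s := _ ^+ l; set t := _ ^+ k => s0 t0.
apply/andP; split; first by nra.
have := sqr_ge0 (s - t); have := sqr_ge0 (s - 1); have := sqr_ge0 (t - 1); nra.
Qed.

Lemma hamiltonian_weight (R : realType) (n k l : nat) (p q : mpoly n R)
    (p0 q0 : R) :
  poly_class k p -> poly_class l q -> 0 < p0 -> 0 < q0 ->
  (forall x : 'rV[R]_n, 0 < peval p x + p0) ->
  (forall xi : 'rV[R]_n, 0 < peval q xi + q0) ->
  exists c C : R, [/\ 0 < c, 0 < C & forall X,
    c * symbol_weight k l X ^+ 2 <= hamiltonian p q p0 q0 X <=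
    C * symbol_weight k l X ^+ 2].
Proof.
move=> pk ql p00 q00 ppos qpos.
have [c1 c10 lowp] := peval_lower pk p00 ppos.
have [c2 c20 lowq] := peval_lower ql q00 qpos.
have [C1 C10 upp] := @peval_upper _ _ (2 * k) p (eq_leq pk.1).
have [C2 C20 upq] := @peval_upper _ _ (2 * l) q (eq_leq ql.1).
pose c := Num.min c1 c2; exists (c / 3), (p0 + q0 + C1 + C2).
have c0 : 0 < c by rewrite lt_min c10.
split; [by rewrite divr_gt0|by rewrite !addr_gt0|move=> X].
have /andP[w1 w2] := symbol_weight_sqr k l X.
have := exprn_ge0 (2 * k) (eucl_norm_ge0 X.1).
have := exprn_ge0 (2 * l) (eucl_norm_ge0 X.2).
move: (lowp X.1) (lowq X.2) (upp X.1) (upq X.2) w1 w2; rewrite /hamiltonian.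
have : c <= c1 by rewrite ge_min lexx.
have : c <= c2 by rewrite ge_min lexx orbT.
move: (symbol_weight _ _ _ ^+ 2) (eucl_norm X.1 ^+ _) (eucl_norm X.2 ^+ _) => w s t.
move: (peval p _) (peval q _) => a b cc2 cc1 la lb ua ub w1 w2 t0 s0.
apply/andP; split.
  apply: (@le_trans _ _ (c * (1 + s + t))); first by nra.
  have : c * (1 + s) <= c1 * (1 + s) by rewrite ler_wpM2r// addr_ge0.
  have : c * (1 + t) <= c2 * (1 + t) by rewrite ler_wpM2r// addr_ge0.
  nra.
apply: (@le_trans _ _ ((p0 + q0 + C1 + C2) * (1 + s + t))); last first.
  by rewrite ler_wpM2l// ltW// !addr_gt0.
have : 0 <= C1 * t by rewrite mulr_ge0// ltW.
have : 0 <= C2 * s by rewrite mulr_ge0// ltW.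
have : 0 <= p0 * (s + t) by rewrite mulr_ge0// ?addr_ge0// ltW.
have : 0 <= q0 * (s + t) by rewrite mulr_ge0// ?addr_ge0// ltW.
nra.
Qed.

Lemma powR_monotone (R : realType) (s a b : R) :
  0 <= s -> 0 <= a -> a <= b -> a `^ s <= b `^ s.
Proof.
by move=> s0 a0 ab; rewrite ge0_ler_powR// nnegrE// (le_trans a0).
Qed.

(** For [s < 0] the map [t -> t^s] is decreasing, so that the lower bound on [b]
    is then the one that matters. *)
Lemma powR_comparison (R : realType) (c C s : R) : 0 < c -> 0 < C ->
  exists2 K : R, 0 < K & forall a b : R, 0 < a -> c * a <= b <= C * a ->
    b `^ s <= K * a `^ s.
Proof.
move=> c0 C0; have [s0|s0] := leP 0 s.
  exists (C `^ s); first exact: powR_gt0.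
  move=> a b a0 /andP[cb bC]; rewrite -powRM ?(ltW a0) ?(ltW C0)//.
  apply: powR_monotone => //.
  by apply: le_trans cb; rewrite mulr_ge0// ltW.
exists (c `^ s); first exact: powR_gt0.
move=> a b a0 /andP[cb _]; rewrite -powRM ?(ltW a0) ?(ltW c0)//.
have ca0 : 0 < c * a by rewrite mulr_gt0.
have b0 := lt_le_trans ca0 cb.
rewrite -(opprK s) !(powRN _ (- s)) lef_pV2 ?posrE ?powR_gt0//.
by apply: powR_monotone => //; rewrite ?oppr_ge0 ltW.
Qed.

(** * Derivatives along coordinate directions *)

Lemma powR_sqrt (R : realType) (a s : R) : 0 < a ->
  Num.sqrt (a `^ s) = a `^ (s / 2).
Proof. by move=> a0; rewrite powRrM powR12_sqrt// powR_ge0. Qed.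

Definition axis (R : realType) (n : nat) (b : 'I_n + 'I_n) : phase R n :=
  match b with inl i => (delta_mx 0 i, 0) | inr i => (0, delta_mx 0 i) end.

Definition phase_coord (R : realType) (n : nat) (T : phase R n) (b : 'I_n + 'I_n) : R :=
  match b with inl i => T.1 0 i | inr i => T.2 0 i end.

Definition axis_order (R : realType) (n k l : nat) (b : 'I_n + 'I_n) : R :=
  match b with inl _ => k%:R^-1 | inr _ => l%:R^-1 end.

Definition orders (R : realType) (n k l : nat) (bs : seq ('I_n + 'I_n)) : R :=
  \sum_(b <- bs) axis_order R k l b.

Lemma axis_decomposition (R : realType) (n : nat) (T : phase R n) :
  T = \sum_b phase_coord T b *: axis R b.
Proof.
rewrite [LHS]surjective_pairing [RHS]surjective_pairing !raddf_sum.
congr (_, _); rewrite big_sumType/=.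
  rewrite {1}(row_sum_delta T.1) [X in _ + X]big1 ?addr0// => i _.
  by rewrite scaler0.
rewrite {1}(row_sum_delta T.2) [X in X + _]big1 ?add0r// => i _.
by rewrite scaler0.
Qed.

Lemma iter_derive_cat (R : realType) (V W : normedModType R) (f : V -> W)
    (us vs : seq V) :
  iter_derive f (us ++ vs) = iter_derive (iter_derive f vs) us.
Proof. by rewrite /iter_derive foldr_cat. Qed.

Lemma iterated_partials (R : realType) (I : Type) (V W : normedModType R)
    (f : V -> W) (e : I -> V) (c : I -> nat) (s : seq I) :
  foldr (fun i g => iter (c i) (fun h => 'D_(e i) h) g) f s =
  iter_derive f (map e (flatten [seq nseq (c i) i | i <- s])).
Proof.
elim: s => //= i s ->; rewrite map_cat iter_derive_cat.
by elim: (c i) => //= d ->.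
Qed.

(** The list of coordinate directions along which [partial_x beta] and
    [partial_xi alpha] differentiate, in the order that they use. *)
Definition multi_axes (n : nat) (alpha beta : multinom n) : seq ('I_n + 'I_n) :=
  map inl (flatten [seq nseq (beta i) i | i <- enum 'I_n]) ++
  map inr (flatten [seq nseq (alpha i) i | i <- enum 'I_n]).

Lemma mixed_partialE (R : realType) (n : nat) (alpha beta : multinom n)
    (a : phase R n -> Rcomplex R) :
  partial_x beta (partial_xi alpha a) =
  iter_derive a (map (@axis R n) (multi_axes alpha beta)).
Proof.
rewrite map_cat iter_derive_cat.
rewrite -(map_comp (@axis R n) inl) -(map_comp (@axis R n) inr).
have E1 := iterated_partials a (fun i => axis R (inr i)) alpha (enum 'I_n).
have E2 f := iterated_partials f (fun i => axis R (inl i)) beta (enum 'I_n).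
by rewrite /partial_xi; rewrite E1; rewrite /partial_x E2.
Qed.

Lemma count_flatten_nseq (n : nat) (c : 'I_n -> nat) (i : 'I_n) :
  count_mem i (flatten [seq nseq (c j) j | j <- enum 'I_n]) = c i.
Proof.
rewrite count_flatten sumnE 2!big_map big_enum/= (bigD1 i)//= count_nseq/= eqxx mul1n.
by rewrite big1 ?addn0// => j ji; rewrite count_nseq/= (negPf ji).
Qed.

Lemma size_flatten_nseq (n : nat) (c : multinom n) :
  size (flatten [seq nseq (c j) j | j <- enum 'I_n]) = mdeg c.
Proof.
rewrite size_flatten sumnE 2!big_map big_enum/= mdegE.
by apply: eq_bigr => i _; rewrite size_nseq.
Qed.

Lemma orders_multi_axes (R : realType) (n k l : nat) (alpha beta : multinom n) :
  orders R k l (multi_axes alpha beta) =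
  (mdeg beta)%:R / k%:R + (mdeg alpha)%:R / l%:R.
Proof.
rewrite /orders big_cat/= !big_map/= !big_const_seq !count_predT !size_flatten_nseq.
by rewrite !iter_addr_0 !mulr_natl.
Qed.

(** The exponents are the multiplicities of the axes in [bs]. *)
Lemma perm_multi_axes (n : nat) (bs : seq ('I_n + 'I_n)) :
  exists alpha beta, perm_eq bs (multi_axes alpha beta).
Proof.
exists (Multinom (mktuple (fun i => count_mem (inr i) bs))).
exists (Multinom (mktuple (fun i => count_mem (inl i) bs))).
apply/allP => /= b _; apply/eqP; rewrite /multi_axes count_cat !count_map.
case: b => i /=.
  rewrite [X in (_ + X)%N](eq_count (a2 := pred0))// count_pred0 addn0.
  rewrite (eq_count (a2 := pred1 i)); last by move=> j /=; rewrite (inj_eq inl_inj).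
  by rewrite count_flatten_nseq mnmE.
rewrite [X in (X + _)%N](eq_count (a2 := pred0))// count_pred0 add0n.
rewrite (eq_count (a2 := pred1 i)); last by move=> j /=; rewrite (inj_eq inr_inj).
by rewrite count_flatten_nseq mnmE.
Qed.

(** By symmetry of derivatives, the sorted lists of axes given by pairs of
    multi-indices may be replaced by arbitrary lists, which are the ones produced
    by expanding directions on the basis one after the other. *)
Lemma Sigma_axes (R : realType) (n k l : nat) (m : R)
    (a : phase R n -> Rcomplex R) :
  Sigma k l m a <-> smooth a /\ forall bs : seq ('I_n + 'I_n),
    exists C : R, 0 < C /\ forall X : phase R n,
      `|iter_derive a (map (@axis R n) bs) X| <=
      C * symbol_weight k l X `^ (m - orders R k l bs).
Proof.
split=> -[sa aC]; split=> //.
  move=> bs; have [alpha [beta bsE]] := perm_multi_axes bs.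
  have [C [C0 CE]] := aC alpha beta; exists C; split=> // -[x xi].
  have -> : orders R k l bs = orders R k l (multi_axes alpha beta).
    exact: perm_big.
  rewrite orders_multi_axes opprD addrA.
  rewrite (perm_iter_derive sa (perm_map (@axis R n) bsE)) -mixed_partialE.
  exact: CE.
move=> alpha beta; have [C [C0 CE]] := aC (multi_axes alpha beta).
exists C; split=> // x xi; have := CE (x, xi).
by rewrite orders_multi_axes opprD addrA -mixed_partialE.
Qed.

(** * The metric on coordinate directions *)

(** The exponents cancel: [(k + l) / (2 k l)] times [m k l / (k + l)] is [m / 2]. *)
Lemma uncertainty_powR (R : realType) (n k l : nat) (m : R) (p q : mpoly n R)
    (p0 q0 : R) (X : phase R n) :
  (0 < k)%N -> (0 < l)%N ->
  uncertainty k l p q p0 q0 X `^ (m * ((k * l)%:R / (k + l)%:R)) =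
  hamiltonian p q p0 q0 X `^ (m / 2).
Proof.
move=> k0 l0; rewrite /uncertainty -powRrM; congr (_ `^ _).
rewrite !natrM natrD; field.
by rewrite -natrD !pnatr_eq0 -!lt0n k0 l0 addn_gt0 k0.
Qed.

Lemma sqrt_metric_axis (R : realType) (n k l : nat) (p q : mpoly n R)
    (p0 q0 : R) (X : phase R n) (b : 'I_n + 'I_n) :
  0 < hamiltonian p q p0 q0 X ->
  Num.sqrt (metric k l p q p0 q0 X (axis R b)) =
  hamiltonian p q p0 q0 X `^ (- (axis_order R k l b / 2)).
Proof.
move=> H0; rewrite powRN /metric.
by case: b => i /=; rewrite eucl_norm_delta eucl_norm0 expr0n/= mul0r
   ?addr0 ?add0r expr1n mul1r sqrtrV ?powR_ge0// powR_sqrt.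
Qed.

Lemma prod_sqrt_metric_axes (R : realType) (n k l : nat) (p q : mpoly n R)
    (p0 q0 : R) (X : phase R n) (bs : seq ('I_n + 'I_n)) :
  0 < hamiltonian p q p0 q0 X ->
  \prod_(b <- bs) Num.sqrt (metric k l p q p0 q0 X (axis R b)) =
  hamiltonian p q p0 q0 X `^ (- (orders R k l bs / 2)).
Proof.
move=> H0; rewrite /orders; elim: bs => [|b bs IH].
  by rewrite !big_nil mul0r oppr0 powRr0.
rewrite !big_cons IH sqrt_metric_axis// -powRD ?(gt_eqF H0) ?implybT//.
by rewrite mulrDl opprD.
Qed.

Lemma ler_coord_metric (R : realType) (n k l : nat) (p q : mpoly n R)
    (p0 q0 : R) (X T : phase R n) (b : 'I_n + 'I_n) :
  0 < hamiltonian p q p0 q0 X ->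
  `|phase_coord T b| <= Num.sqrt (metric k l p q p0 q0 X T) *
    hamiltonian p q p0 q0 X `^ (axis_order R k l b / 2).
Proof.
move=> H0; have key (e f s t : R) : 0 <= e -> 0 < s -> 0 < t ->
    e <= Num.sqrt (e ^+ 2 / s + f ^+ 2 / t) * Num.sqrt s.
  move=> e0 /[dup] s0 /ltW s0' /ltW t0'.
  have ft : 0 <= f ^+ 2 / t by rewrite divr_ge0 ?sqr_ge0.
  have es : 0 <= e ^+ 2 / s by rewrite divr_ge0 ?sqr_ge0.
  rewrite -sqrtrM ?addr_ge0// -{1}(ger0_norm e0) -sqrtr_sqr ler_wsqrtr//.
  by rewrite mulrDl divfK ?gt_eqF// lerDl mulr_ge0.
have pos s : 0 < hamiltonian p q p0 q0 X `^ s by exact: powR_gt0.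
rewrite -powR_sqrt// /metric; case: b => i /=.
  apply: le_trans (key _ _ _ _ (eucl_norm_ge0 _) (pos _) (pos _)).
  exact: ler_coord_eucl_norm.
rewrite addrC; apply: le_trans (key _ _ _ _ (eucl_norm_ge0 _) (pos _) (pos _)).
exact: ler_coord_eucl_norm.
Qed.

(** By induction on the number of arbitrary directions, for all lists [bs] of
    coordinate directions at once: the outermost direction is expanded on the
    basis and, by symmetry, each resulting axis joins [bs]. Its coordinate costs
    [H^(axis_order b / 2)], which is what the bound for [b :: bs] gains. *)
Lemma multilinear_bound (R : realType) (n k l : nat) (m : R) (p q : mpoly n R)
    (p0 q0 : R) (a : phase R n -> Rcomplex R) :
  (forall X : phase R n, 0 < hamiltonian p q p0 q0 X) -> smooth a ->
  (forall bs : seq ('I_n + 'I_n), exists C : R, 0 < C /\ forall X : phase R n,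
     `|iter_derive a (map (@axis R n) bs) X| <=
       C * hamiltonian p q p0 q0 X `^ ((m - orders R k l bs) / 2)) ->
  forall (j : nat) (bs : seq ('I_n + 'I_n)), exists C : R, 0 < C /\
    forall (Ts : seq (phase R n)) (X : phase R n), size Ts = j ->
      `|iter_derive a (Ts ++ map (@axis R n) bs) X| <=
      C * hamiltonian p q p0 q0 X `^ ((m - orders R k l bs) / 2) *
      \prod_(T <- Ts) Num.sqrt (metric k l p q p0 q0 X T).
Proof.
move=> H0 sa base; elim=> [|j IH] bs.
  have [C [C0 CE]] := base bs; exists C; split=> // Ts X /size0nil ->.
  by rewrite big_nil mulr1; exact: CE.
have /choice[C CE] := fun b => IH (b :: bs).
(* The 1 keeps the constant positive when there is no axis. *)
exists (1 + \sum_b C b); split.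
  by rewrite ltr_pwDl// sumr_ge0// => b _; rewrite ltW//; case: (CE b).
case=> [//|T Ts] X [jE].
set f := iter_derive a (Ts ++ map (@axis R n) bs).
set P := \prod_(T <- Ts) Num.sqrt (metric k l p q p0 q0 X T).
have df : differentiable f X by exact: sa.
have -> : iter_derive a ((T :: Ts) ++ map (@axis R n) bs) X =
    \sum_b phase_coord T b *: 'D_(axis R b) f X.
  rewrite /= -/f deriveE// {1}(axis_decomposition T) linear_sum.
  by apply: eq_bigr => b _; rewrite linearZ deriveE.
have Df b : `|'D_(axis R b) f X| <=
    C b * hamiltonian p q p0 q0 X `^ ((m - orders R k l (b :: bs)) / 2) * P.
  have [_ /(_ Ts X jE)] := CE b; congr (`|_| <= _).
  have := @perm_iter_derive R _ a (Ts ++ map (@axis R n) (b :: bs))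
    (axis R b :: Ts ++ map (@axis R n) bs) sa.
  move=> ->//; apply/permPl.
  exact: perm_catCA Ts [:: axis R b] (map (@axis R n) bs).
rewrite (le_trans (ler_norm_sum _ _ _))//.
rewrite big_cons -/P.
apply: (@le_trans _ _ ((\sum_b C b) *
    hamiltonian p q p0 q0 X `^ ((m - orders R k l bs) / 2) *
    (Num.sqrt (metric k l p q p0 q0 X T) * P))).
  rewrite !mulr_suml ler_sum// => b _; rewrite normrZ.
  apply: (le_trans (ler_pM (normr_ge0 _) (normr_ge0 _)
    (ler_coord_metric k l T b (H0 X)) (Df b))).
  have -> : (m - orders R k l bs) / 2 =
      axis_order R k l b / 2 + (m - orders R k l (b :: bs)) / 2.
    by rewrite /orders big_cons; field.
  rewrite powRD ?(gt_eqF (H0 X)) ?implybT//.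
  by rewrite le_eqVlt; apply/orP; left; apply/eqP; ring.
have P0 : 0 <= P by apply: prodr_ge0 => ? _; exact: sqrtr_ge0.
rewrite ler_wpM2r ?mulr_ge0 ?sqrtr_ge0//.
by rewrite ler_wpM2r ?powR_ge0// lerDr.
Qed.

(** * Equality of the symbol classes *)

Theorem corollary4p3 (R : realType) (n : nat) (m : R) (k l : nat)
    (p q : mpoly n R) (p0 q0 : R) :
  (0 < n)%N -> (0 < k)%N -> (0 < l)%N ->
  poly_class k p -> poly_class l q ->
  0 < p0 -> 0 < q0 ->
  (forall x : 'rV[R]_n, 0 < peval p x + p0) ->
  (forall xi : 'rV[R]_n, 0 < peval q xi + q0) ->
  symbols (fun X => uncertainty k l p q p0 q0 X
                      `^ (m * ((k * l)%:R / (k + l)%:R)))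
          (metric k l p q p0 q0)
  = Sigma k l m.
Proof.
move=> _ k0 l0 pk ql p00 q00 ppos qpos.
have [c [C [c0 C0 Hw]]] := hamiltonian_weight pk ql p00 q00 ppos qpos.
have w0 (X : phase R n) : 0 < symbol_weight k l X.
  exact: lt_le_trans (symbol_weight_ge1 k l X).
have w20 (X : phase R n) : 0 < symbol_weight k l X ^+ 2 by exact: exprn_gt0 (w0 X).
have H0 X : 0 < hamiltonian p q p0 q0 X.
  have /andP[cH _] := Hw X.
  exact: lt_le_trans (mulr_gt0 c0 (w20 X)) cH.
have w2E (X : phase R n) s : (symbol_weight k l X ^+ 2) `^ (s / 2) =
    symbol_weight k l X `^ s.
  by rewrite -powR_mulrn ?(ltW (w0 X))// -powRrM mulrC divfK// pnatr_eq0.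
apply/seteqP; split=> a.
  move=> [sa aC]; apply/Sigma_axes; split=> // bs.
  have [K [K0 KE]] := aC (size (map (@axis R n) bs)).
  have [K' K'0 K'E] := powR_comparison ((m - orders R k l bs) / 2) c0 C0.
  exists (K * K'); split=> [|X]; first by rewrite mulr_gt0.
  apply: (le_trans (KE X (in_tuple (map (@axis R n) bs)))).
  rewrite -(big_tuple _ _ (in_tuple (map (@axis R n) bs)) predT
             (fun T => Num.sqrt (metric k l p q p0 q0 X T)))/= big_map.
  rewrite uncertainty_powR// prod_sqrt_metric_axes//.
  rewrite -!mulrA ler_wpM2l ?(ltW K0)//.
  rewrite -powRD ?(gt_eqF (H0 X)) ?implybT// -mulrBl -w2E.
  exact: K'E.
move=> /Sigma_axes[sa aC]; split=> // j.
have [bs | K [K0 KE]] := @multilinear_bound R n k l m p q p0 q0 a H0 sa _ j [::].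
  have [K [K0 KE]] := aC bs.
  (* The same comparison, read as [H / C <= w^2 <= H / c]. *)
  have Ci0 : 0 < C^-1 by rewrite invr_gt0.
  have ci0 : 0 < c^-1 by rewrite invr_gt0.
  have [K' K'0 K'E] := powR_comparison ((m - orders R k l bs) / 2) Ci0 ci0.
  exists (K * K'); split=> [|X]; first by rewrite mulr_gt0.
  rewrite (le_trans (KE X))// -mulrA ler_wpM2l ?(ltW K0)// -w2E.
  apply: K'E => //; have /andP[cH HC] := Hw X.
  by rewrite ler_pdivrMl// HC ler_pdivlMl.
exists K; split=> // X T; have := KE T X (size_tuple T).
rewrite cats0 uncertainty_powR// /orders big_nil subr0 => /le_trans; apply.
by rewrite big_tuple.
Qed.
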